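(* Let $X$ be a second countable topological $T_1$-space without isolated points. Let $\mathcal A$ be the $\sigma$-algebra of subsets of $X$ having the Baire property and $\mathcal K$ the $\sigma$-ideal of first category (meager) subsets of $X$. Then every infinite subset $E$ of $X$ can be decomposed into the union of an infinite family of pairwise disjoint subsets, each of which is a $\mathcal K$-full subset of $E$ (equivalently, each of which is a completely non-Baire subset of $E$).
   Context: A subset of $X$ has the Baire property if it can be written as $(O\smallsetminus P)\cup Q$ with $O$ open and $P,Q$ of first category. For $E\subset Q\subset X$, $E$ is a $\mathcal K$-full subset of $Q$ if for each $B\in\mathcal A$ with $E\subset B$ one has $Q\smallsetminus B\in\mathcal K$. A subset $E\subset Q$ is a completely non-Baire subset of $Q$ if for each $A\in\mathcal A$ with $A\cap Q\notin\mathcal K$ one has $A\cap E\notin\mathcal K$ and $A\cap(Q\smallsetminus E)\notin\mathcal K$. *)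

(* Defs.v *)
From mathcomp Require Import all_boot all_order.
From mathcomp Require Import all_classical topology.

Set Implicit Arguments.
Unset Strict Implicit.
Unset Printing Implicit Defensive.

Local Open Scope classical_set_scope.

Definition nowhere_dense (X : topologicalType) (N : set X) : Prop :=
  interior (closure N) = set0.

Definition first_category (X : topologicalType) (M : set X) : Prop :=
  exists2 N : nat -> set X,
    (forall n, nowhere_dense (N n)) & M = \bigcup_n N n.

Definition Baire_property (X : topologicalType) (B : set X) : Prop :=
  exists O P Q : set X,
    [/\ open O, first_category P, first_category Q & B = (O `\` P) `|` Q].

(* [sA] and [sK] stand for the sigma-algebra and the sigma-ideal. *)
Definition full_subset (X : Type) (sA sK : set (set X)) (Q E : set X) : Prop :=
  E `<=` Q /\ forall B, sA B -> E `<=` B -> sK (Q `\` B).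

Definition completely_non_Baire_subset (X : Type) (sA sK : set (set X))
    (Q E : set X) : Prop :=
  E `<=` Q /\
  forall A, sA A -> ~ sK (A `&` Q) ->
    ~ sK (A `&` E) /\ ~ sK (A `&` (Q `\` E)).

(* [F] is a set of sets, so an infinite [F] has infinitely many distinct,
   hence all but one nonempty, members. *)
Definition infinite_decomposition (X : Type) (E : set X)
    (F : set (set X)) : Prop :=
  [/\ infinite_set F, trivIset F id & \bigcup_(D in F) D = E].

(* Main.v *)
(* Fullness in [E] only has to be tested on traces of open sets: [D] is full in
   [E] iff every open set meeting [D] in a meager set meets [E] in a meager set.
   The heart is Lusin's theorem that [E] splits into two full subsets: where it
   does not, all subsets of [E] are relatively open modulo meager sets, and the
   Kuratowski-Ulam argument applied to a well-ordering of [E] with meager initial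
   segments shows that this part of [E] is meager.  Local splittings are glued
   along a countable base, and splitting one half again and again yields
   infinitely many full pieces.  A meager [E] is cut into singletons. *)

Require Import Defs.
From mathcomp Require Import all_boot all_order.
From mathcomp Require Import all_classical topology.
From mathcomp Require wochoice.

Set Implicit Arguments.
Unset Strict Implicit.
Unset Printing Implicit Defensive.

Local Open Scope classical_set_scope.

(** * Nowhere dense and first category sets *)

Lemma nowhere_denseP (X : topologicalType) (N : set X) :
  nowhere_dense N <->
  forall V, open V -> V !=set0 ->
    exists W, [/\ open W, W !=set0, W `<=` V & W `&` N = set0].
Proof.
split=> [ndN V oV [v Vv]|h].
  exists (V `\` closure N); split.
  - by apply: openI => //; apply/closed_openC/closed_closure.
  - apply/set0P/eqP => VN0.
    have : interior (closure N) v.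
      apply: filterS (open_nbhs_nbhs (conj oV Vv)) => x Vx.
      apply: contrapT => nx.
      by have : set0 x by rewrite -VN0.
    by rewrite ndN.
  - by move=> x [].
  - by rewrite -subset0 => x [[_ ncx] /subset_closure].
apply/eqP; apply: contrapT => /negP/set0P ne.
have [W [oW [y Wy] WV WN0]] := h _ (open_interior _) ne.
have /interior_subset cly := WV _ Wy.
have [z [Nz Wz]] := cly W (open_nbhs_nbhs (conj oW Wy)).
by have : set0 z by rewrite -WN0.
Qed.

Lemma nowhere_dense_subset (X : topologicalType) (M N : set X) :
  M `<=` N -> nowhere_dense N -> nowhere_dense M.
Proof.
move=> MN /nowhere_denseP h; apply/nowhere_denseP => V oV V0.
have [W [oW W0 WV WN]] := h V oV V0; exists W; split=> //.
by rewrite -subset0 -WN => x [Wx /MN].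
Qed.

Lemma nowhere_dense0 (X : topologicalType) : nowhere_dense (set0 : set X).
Proof. by rewrite /nowhere_dense closure0 interior0. Qed.

(** Lets an open set be exchanged for its closure at the cost of a meager set, so that tests can be
    made on the open complement of the closure. *)
Lemma nowhere_dense_boundary (X : topologicalType) (O : set X) :
  open O -> nowhere_dense (closure O `\` O).
Proof.
move=> oO; apply/nowhere_denseP => V oV V0.
have [VO|VO] := pselect (V `&` O !=set0).
  exists (V `&` O); split=> //; first exact: openI.
  by rewrite -subset0 => x [[_ Ox] []].
exists V; split=> //; rewrite -subset0 => x [Vx [clx _]].
by have [y [Oy Vy]] := clx V (open_nbhs_nbhs (conj oV Vx)); case: VO; exists y.
Qed.

Lemma first_category_subset (X : topologicalType) (M N : set X) :
  M `<=` N -> first_category N -> first_category M.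
Proof.
move=> MN [F ndF eN]; exists (fun n => F n `&` M) => [n|].
  exact: nowhere_dense_subset (@subIsetl _ _ _) (ndF n).
rewrite -setI_bigcupl -eN; apply/seteqP; split=> [x Mx|x []//].
by split=> //; apply: MN.
Qed.

Lemma nowhere_dense_first_category (X : topologicalType) (N : set X) :
  nowhere_dense N -> first_category N.
Proof. by move=> ndN; exists (fun=> N) => //; rewrite bigcup_const. Qed.

Lemma first_category0 (X : topologicalType) : first_category (set0 : set X).
Proof. exact/nowhere_dense_first_category/nowhere_dense0. Qed.

Lemma first_category_bigcup (X : topologicalType) (I : countType)
    (F : I -> set X) :
  (forall i, first_category (F i)) -> first_category (\bigcup_i F i).
Proof.
move=> fcF.
have /choice [N NP] (i : I) : exists N : nat -> set X,
    (forall n, nowhere_dense (N n)) /\ F i = \bigcup_n N n.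
  by case: (fcF i) => N ? ?; exists N.
exists (fun k => if unpickle k is Some (i, n) then N i n else set0) => [k|].
  case: (unpickle k) => [[i n]|]; first by case: (NP i).
  exact: nowhere_dense0.
apply/seteqP; split=> [x [i _]|x [k _]].
  by rewrite (NP i).2 => -[n _ Nx]; exists (pickle (i, n)); rewrite ?pickleK.
case: (unpickle k) => [[i n] Nx|//].
by exists i => //; rewrite (NP i).2; exists n.
Qed.

Lemma first_categoryU (X : topologicalType) (M N : set X) :
  first_category M -> first_category N -> first_category (M `|` N).
Proof.
move=> fM fN.
apply: (@first_category_subset _ _ (\bigcup_(b : bool) if b then M else N)).
  by move=> x [Mx|Nx]; [exists true|exists false].
by apply: first_category_bigcup => -[].
Qed.

(** The singleton is closed by T1, and a nonempty interior would make its point isolated. *)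
Lemma first_category1 (X : topologicalType) (x : X) :
  accessible_space X -> isolated [set: X] = set0 -> first_category [set x].
Proof.
move=> T1 noiso; apply: nowhere_dense_first_category.
have cl1 : closed [set x] by exact: accessible_closed_set1.
rewrite /nowhere_dense -(closure_id _).1 //.
rewrite -subset0 => y yx; have /interior_subset /= eyx := yx.
suff : isolated [set: X] y by rewrite noiso.
split; first exact: in_setT.
by exists [set x] => //; rewrite setIT eyx.
Qed.

(** * Countable bases and the open part where a set is meager *)

Definition countable_base (X : topologicalType) (U : nat -> set X) : Prop :=
  (forall n, open (U n)) /\
  forall (O : set X) x, open O -> O x -> exists n, U n x /\ U n `<=` O.

Lemma second_countable_base (X : topologicalType) :
  @second_countable X -> exists U : nat -> set X, countable_base U.
Proof.
case=> B /countable_injP [f finj] [Bo Bb].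
(* The union has at most one member, [f] being injective on [B]; a number that codes no member gives
   the empty set. *)
exists (fun n => \bigcup_(V in [set V | B V /\ f V = n]) V); split.
  by move=> n; apply: bigcup_open => V [/Bo].
move=> O x oO Ox.
have [V [BV Vx] VO] := Bb x O (open_nbhs_nbhs (conj oO Ox)).
exists (f V); split; first by exists V.
move=> y [W [BW fWV] Wy]; apply: VO.
by rewrite -(finj _ _ _ _ fWV) // inE.
Qed.

Definition meager_open_part (X : topologicalType) (A : set X) : set X :=
  \bigcup_(V in [set V | open V /\ first_category (V `&` A)]) V.

Lemma open_meager_open_part (X : topologicalType) (A : set X) :
  open (meager_open_part A).
Proof. by apply: bigcup_open => V []. Qed.

(** Banach's category theorem, easy here: countably many basic sets with meager trace on [A] already
    cover. Indices with nonmeager trace contribute the empty set. *)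
Lemma meager_open_partP (X : topologicalType) (U : nat -> set X) (A : set X) :
  countable_base U -> first_category (meager_open_part A `&` A).
Proof.
move=> [Uo Ub].
apply: (@first_category_subset _ _
  (\bigcup_n [set x | first_category (U n `&` A) /\ (U n `&` A) x])).
  move=> x [[V [oV fV] Vx] Ax]; have [n [Unx UnV]] := Ub V x oV Vx.
  exists n => //; split=> //; apply: first_category_subset fV => y [/UnV ? ?].
  by split.
apply: first_category_bigcup => n.
have [fn|nfn] := pselect (first_category (U n `&` A)).
  by apply: first_category_subset fn => x [].
by apply: first_category_subset (first_category0 X) => x [].
Qed.

(** * Fullness tested on open sets *)

Definition openly_full (X : topologicalType) (Q E : set X) : Prop :=
  forall V, open V -> first_category (V `&` E) -> first_category (V `&` Q).

Lemma openly_full_subset (X : topologicalType) (Q D E : set X) :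
  D `<=` E -> openly_full Q D -> openly_full Q E.
Proof.
move=> DE h V oV fV; apply: h => //.
by apply: first_category_subset fV => x [? /DE].
Qed.

Lemma openly_full_trans (X : topologicalType) (Q E D : set X) :
  openly_full Q E -> openly_full E D -> openly_full Q D.
Proof. by move=> QE ED V oV /(ED V oV)/(QE V oV). Qed.

(** If [E] is meager in an open [V], the complement of [V] together with the trace of [E] on [V] is
    a Baire set [B] containing [E], and it omits just the points of [V] outside [E]. Conversely, off
    the closure of [O] the set [E] lies in [M], so [Q] is meager there; the other points of [Q]
    outside [B] are in the boundary of [O] or in [P]. *)
Lemma full_subsetP (X : topologicalType) (Q E : set X) : E `<=` Q ->
  full_subset (@Baire_property X) (@first_category X) Q E <-> openly_full Q E.
Proof.
move=> EQ; split=> [[_ h] V oV fV|h].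
  have bdV := nowhere_dense_first_category (nowhere_dense_boundary oV).
  pose B := ~` closure V `|` ((closure V `\` V) `|` (V `&` E)).
  have BP : Baire_property B.
    exists (~` closure V), set0, ((closure V `\` V) `|` (V `&` E)); split.
    - exact/closed_openC/closed_closure.
    - exact: first_category0.
    - exact: first_categoryU.
    - by rewrite setD0.
  have EB : E `<=` B.
    move=> x Ex; have [Vx|nVx] := pselect (V x); first by right; right.
    by have [cx|ncx] := pselect (closure V x); [right; left|left].
  apply: first_category_subset (first_categoryU fV (h B BP EB)) => x [Vx Qx].
  have [Ex|nEx] := pselect (E x); [by left|right; split=> //].
  by move=> [|[[]|[]]] // /(_ (subset_closure Vx)).
split=> // B [O [P [M [oO fP fM ->]]]] EB.
have bdO := nowhere_dense_first_category (nowhere_dense_boundary oO).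
have fV : first_category (~` closure O `&` Q).
  apply: h; first exact/closed_openC/closed_closure.
  apply: first_category_subset fM => x [ncx Ex].
  by have [[/subset_closure]|] := EB x Ex.
apply: first_category_subset
  (first_categoryU fV (first_categoryU bdO fP)) => x [Qx nB].
have [cx|ncx] := pselect (closure O x); last by left.
right; have [Ox|nOx] := pselect (O x); last by left.
by right; apply: contrapT => nPx; apply: nB; left.
Qed.

Lemma completely_non_Baire_openly_full (X : topologicalType) (Q E : set X) :
  completely_non_Baire_subset (@Baire_property X) (@first_category X) Q E ->
  openly_full Q E.
Proof.
move=> [_ h] V oV fV; apply: contrapT => nf.
have VB : Baire_property V.
  exists V, set0, set0; split=> //; try exact: first_category0.
  by rewrite setD0 setU0.
by have [] := h V VB nf.
Qed.

(** A Baire set differs from its open part [O] by a meager set, so both traces can be tested on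
    [O]. *)
Lemma openly_full_completely_non_Baire (X : topologicalType) (Q E : set X) :
  E `<=` Q -> openly_full Q E -> openly_full Q (Q `\` E) ->
  completely_non_Baire_subset (@Baire_property X) (@first_category X) Q E.
Proof.
move=> EQ fE fC; split=> // _ [O [P [M [oO fP fM ->]]]] nf.
have trace D : openly_full Q D ->
    ~ first_category (((O `\` P) `|` M) `&` D).
  move=> fD fA; apply: nf.
  have fO : first_category (O `&` Q).
    apply: fD => //; apply: first_category_subset (first_categoryU fA fP).
    move=> x [Ox Dx]; have [Px|nPx] := pselect (P x); first by right.
    by left; split=> //; left.
  apply: first_category_subset (first_categoryU fO fM) => x.
  by case=> -[[Ox _]|Mx] Qx; [left|right].
by split; apply: trace.
Qed.

(** * Well-orderings and sets whose subsets are all open modulo meager sets *)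

(** Well-order [X]. If some point of [R] has a nonmeager initial segment in [R], the segment of the
    least such point serves as [E]; otherwise [R] itself does. *)
Lemma nonmeager_subset_meager_initial_segments
    (X : topologicalType) (R : set X) :
  ~ first_category R ->
  exists E (prec : X -> X -> Prop),
    [/\ E `<=` R, ~ first_category E,
        forall x, E x -> first_category [set y | E y /\ prec y x] &
        forall x y, x = y \/ prec x y \/ prec y x].
Proof.
move=> nfR; have [le wo] := wochoice.well_ordering_principle X.
(* The well-ordering is given as unique minima of nonempty predicates; the order axioms are read off
   from pairs. *)
have tot x y : le x y \/ le y x.
  have [|z [[zxy lb] _]] := wo (pred2 x y); first by exists x; rewrite inE eqxx.
  by move: zxy; rewrite inE => /orP[]/eqP <-;
    [left|right]; apply: lb; rewrite inE eqxx ?orbT.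
have refl x : le x x by have [] := tot x x.
have anti x y : le x y -> le y x -> x = y.
  move=> lxy lyx.
  have [|z [_ uz]] := wo (pred2 x y); first by exists x; rewrite inE eqxx.
  rewrite -(uz x) ?(uz y) //; split; rewrite ?inE ?eqxx ?orbT // => w;
  by rewrite inE => /orP[]/eqP ->.
pose prec x y := le x y /\ x <> y.
have trich x y : x = y \/ prec x y \/ prec y x.
  have [->|xy] := pselect (x = y); [by left|right].
  by have [?|?] := tot x y; [left|right; split=> // /esym].
pose seg x := [set y | R y /\ prec y x].
have [[z0 z0P]|none] := pselect (exists x, R x /\ ~ first_category (seg x)).
  have [|z [[zP lb] _]] :=
      wo [pred x | `[< R x /\ ~ first_category (seg x) >]].
    by exists z0; apply/asboolP.
  have {zP} [Rz nfz] : R z /\ ~ first_category (seg z).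
    exact/asboolP.
  exists (seg z), prec; split=> //; first by move=> x [].
  move=> x [Rx [lxz xz]]; apply: contrapT => nf; apply: xz; apply: anti => //.
  apply: lb; apply/asboolP; split=> // fx; apply: nf.
  by apply: first_category_subset fx => y [[Ry _] yx].
exists R, prec; split=> // x Rx; apply: contrapT => nf.
by apply: none; exists x.
Qed.

(* If [R] is nonmeager, it has a nonmeager subset [E], well ordered with meager
   initial segments.  Cover the segment below [y] by nowhere dense sets [N y n]
   and let [U (f (y, n, k))] be a basic subset of [U k] missing [N y n].  The
   set [A q] of those [y] where [f] takes a prescribed value is by hypothesis,
   modulo the meager set [M], the trace of an open set [W q].  Hence the open
   plane set [{(x, y) | y in G n x}] has, for [y] in [E] outside [M], dense
   [x]-sections avoiding [N y n].  As in the Kuratowski-Ulam theorem, some [x]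
   in [E] has all its [G n x] dense where [E] is nowhere meager, and then almost
   all of [E] is below [x], which is absurd. *)
Lemma open_mod_meager_first_category (X : topologicalType) (U : nat -> set X)
    (R : set X) :
  countable_base U -> (forall x : X, first_category [set x]) ->
  (forall A, A `<=` R -> exists W,
     [/\ open W, first_category (A `\` W) & first_category ((W `&` R) `\` A)]) ->
  first_category R.
Proof.
move=> bU fc1 hR; apply: contrapT => nfR; have [Uo Ub] := bU.
have [E [prec [ER nfE seg trich]]] :=
  nonmeager_subset_meager_initial_segments nfR.
have /choice [N NP] (y : X) : exists N : nat -> set X, E y ->
    (forall n, nowhere_dense (N n)) /\ [set x | E x /\ prec x y] = \bigcup_n N n.
  have [Ey|nEy] := pselect (E y); last by exists (fun=> set0).
  by have [N ? ?] := seg y Ey; exists N.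
have /choice [f fP] (p : X * nat * nat) : exists m, E p.1.1 ->
    [/\ U m `<=` U p.2, U m `&` N p.1.1 p.1.2 = set0 &
        U p.2 !=set0 -> U m !=set0].
  case: p => [[y n] k] /=; have [Ey|nEy] := pselect (E y); last by exists 0.
  have [U0|U0] := pselect (U k !=set0); last first.
    exists k => _; split=> //; rewrite -subset0 => x [Ux _].
    by apply: U0; exists x.
  have [/(_ n)/nowhere_denseP ndN _] := NP y Ey.
  have [V [oV [v Vv] VU VN]] := ndN _ (Uo k) U0.
  have [m [Umv UmV]] := Ub V v oV Vv.
  exists m => _; split; first exact: subset_trans VU.
    by rewrite -subset0 -VN => x [/UmV ? ?].
  by exists v.
pose A (q : nat * nat * nat) := [set y | E y /\ f (y, q.1.1, q.1.2) = q.2].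
have /choice [W WP] (q : nat * nat * nat) : exists W,
    [/\ open W, first_category (A q `\` W) & first_category ((W `&` R) `\` A q)].
  by apply: hR => y [/ER].
pose M := \bigcup_q ((A q `\` W q) `|` ((W q `&` R) `\` A q)).
have fM : first_category M.
  apply: first_category_bigcup => q; have [_ ? ?] := WP q.
  exact: first_categoryU.
have AW y n k : E y -> ~ M y -> W (n, k, f (y, n, k)) y.
  move=> Ey nM; apply: contrapT => nW; apply: nM.
  by exists (n, k, f (y, n, k)) => //; left.
have WA y q : E y -> ~ M y -> W q y -> f (y, q.1.1, q.1.2) = q.2.
  move=> Ey nM Wy; apply: contrapT => nA; apply: nM.
  by exists q => //; right; split=> [|[]//]; split=> //; apply: ER.
pose G n x := \bigcup_(km in [set km : nat * nat | U km.2 x]) W (n, km.1, km.2).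
have oG n x : open (G n x).
  by apply: bigcup_open => km _; have [] := WP (n, km.1, km.2).
pose O := ~` closure (meager_open_part E).
have oO : open O by exact/closed_openC/closed_closure.
have nfO V : open V -> V !=set0 -> V `<=` O -> ~ first_category (V `&` E).
  move=> oV [v Vv] VO fV; apply: (VO v Vv).
  by apply: subset_closure; exists V.
(* The [x] for which [G n x] fails to meet a given basic set inside [O]. A single [y] of [E] in that
   basic set and outside [M] shows nowhere density: every [U k] contains a nonempty
   [U (f (y, n, k))], and all its points [x] have [y] in [G n x]. *)
pose bad (p : nat * nat) :=
  [set x | [/\ U p.2 `<=` O, U p.2 !=set0 & G p.1 x `&` U p.2 = set0]].
have fbad p : first_category (bad p).
  apply: nowhere_dense_first_category; case: p => n j.
  apply/nowhere_denseP => V oV [v Vv].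
  have [[UO U0]|nU] := pselect (U j `<=` O /\ U j !=set0); last first.
    exists V; split=> //; first by exists v.
    by rewrite -subset0 => x [_ [? ? _]]; apply: nU.
  have [y [[Uy Ey] nMy]] : exists y, (U j `&` E) y /\ ~ M y.
    apply: contrapT => h; apply: (nfO _ (Uo j) U0 UO).
    apply: first_category_subset fM => y UEy; apply: contrapT => nM.
    by apply: h; exists y.
  have [k [Ukv UkV]] := Ub V v oV Vv.
  have [/= mk mN m0] := fP (y, n, k) Ey.
  exists (U (f (y, n, k))); split=> //.
  - by apply: m0; exists v.
  - exact: subset_trans UkV.
  - rewrite -subset0 => x [Umx [_ _ /= /seteqP[+ _]]]; apply; split; last exact: Uy.
    by exists (k, f (y, n, k)) => //=; exact: AW.
have [x [Ex good]] : exists x, E x /\ forall p, ~ bad p x.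
  apply: contrapT => h; apply: nfE.
  apply: first_category_subset (first_category_bigcup fbad) => x Ex.
  apply: contrapT => nb; apply: h; exists x; split=> // p bp; apply: nb.
  by exists p.
have fOG n : first_category (O `\` G n x).
  apply: nowhere_dense_first_category; apply/nowhere_denseP => V oV V0.
  have [[v [Vv Ov]]|VO] := pselect (V `&` O !=set0); last first.
    exists V; split=> //; rewrite -subset0 => z [Vz [Oz _]].
    by apply: VO; exists z.
  have [j [Ujv UjVO]] := Ub (V `&` O) v (openI oV oO) (conj Vv Ov).
  exists (G n x `&` U j); split.
  - exact: openI.
  - apply/set0P/eqP => G0; apply: (good (n, j)); split=> //.
      by move=> z /UjVO[].
    by exists v.
  - by move=> z [_ /UjVO[]].
  - by rewrite -subset0 => z [[Gz _] [_]].
have bdO := nowhere_dense_first_category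
  (nowhere_dense_boundary (open_meager_open_part E)).
apply: nfE.
apply: first_category_subset (first_categoryU
  (first_categoryU (meager_open_partP E bU) bdO)
  (first_categoryU (first_categoryU (fc1 x) (seg x Ex))
     (first_categoryU fM (first_category_bigcup fOG)))) => y Ey.
have [yD|nyD] := pselect (meager_open_part E y); first by left; left.
have [yc|nyc] := pselect (closure (meager_open_part E) y); first by left; right.
right; have [->|[xy|yx]] := trich x y; [by left; left| |by left; right].
right; have [My|nMy] := pselect (M y); first by left.
right; apply: contrapT => nOG.
have Gy n : G n x y.
  by apply: contrapT => nG; apply: nOG; exists n.
(* As [x] precedes [y], it lies in some [N y n]; but [y] in [G n x] puts [x] into a basic set that
   misses [N y n]. *)
have [_ /seteqP[/(_ x (conj Ex xy)) [n _ Nx] _]] := NP y Ey.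
have [[k m] /= Umx Wy] := Gy n.
have /= fm := WA y _ Ey nMy Wy.
have [/= _ /seteqP[+ _] _] := fP (y, n, k) Ey.
by move=> /(_ x); apply; rewrite fm.
Qed.

(** * Gluing local splittings: Lusin's theorem *)

(** A point is assigned to its least good [k]. Off the closure of the earlier good sets the glued
    set contains [T k], so fullness of [T k] applies there; the boundaries left over are meager. *)
Lemma openly_full_glue (X : topologicalType) (U T : nat -> set X)
    (good : set nat) (E : set X) :
  (forall k, open (U k)) ->
  first_category (E `\` \bigcup_(k in good) U k) ->
  (forall k, good k -> openly_full (U k `&` E) (T k)) ->
  openly_full E [set x | exists k, [/\ good k, T k x &
    forall j, j < k -> good j -> ~ U j x]].
Proof.
move=> Uo fE fT V oV fV.
pose P k := \bigcup_(j in [set j | j < k /\ good j]) U j.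
have oP k : open (P k) by exact: bigcup_open.
have bdP k := nowhere_dense_first_category (nowhere_dense_boundary (oP k)).
have fk k : first_category
    [set x | good k /\ (V `&` ~` closure (P k) `&` (U k `&` E)) x].
  have [gk|ngk] := pselect (good k); last first.
    by apply: first_category_subset (first_category0 X) => x [].
  have oVP : open (V `&` ~` closure (P k)).
    by apply: openI => //; apply/closed_openC/closed_closure.
  suff /(fT k gk _ oVP) : first_category (V `&` ~` closure (P k) `&` T k).
    by apply: first_category_subset => x [].
  apply: first_category_subset fV => x [[Vx nPx] Tx]; split=> //.
  exists k; split=> // j jk gj Ujx; apply: nPx; apply: subset_closure.
  by exists j.
apply: first_category_subset (first_categoryU fE (first_categoryU
  (first_category_bigcup bdP) (first_category_bigcup fk))) => x [Vx Ex].
have [[k0 gk0 Uk0]|nG] := pselect ((\bigcup_(k in good) U k) x); last by left.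
right; have [|k /asboolP[gk Ukx] kmin] := @ex_minnP (fun k => `[< good k /\ U k x >]).
  by exists k0; apply/asboolP.
have nP : ~ P k x.
  move=> [j [jk gj] Ujx]; have := kmin j; rewrite leqNgt jk => /(_ _)/notF; apply.
  exact/asboolP.
by have [cP|ncP] := pselect (closure (P k) x); [left; exists k|right; exists k].
Qed.

Lemma openly_full_split (X : topologicalType) (U : nat -> set X) (E : set X) :
  countable_base U -> (forall x : X, first_category [set x]) ->
  exists A, [/\ A `<=` E, openly_full E A & openly_full E (E `\` A)].
Proof.
move=> bU fc1; have [Uo Ub] := bU.
pose splits (Q A : set X) := [/\ A `<=` Q, openly_full Q A & openly_full Q (Q `\` A)].
pose good := [set k | exists A, splits (U k `&` E) A].
pose G := \bigcup_(k in good) U k.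
have oG : open G by exact: bigcup_open.
have fR : first_category (E `\` closure G).
  apply: (open_mod_meager_first_category bU fc1) => A; set R := E `\` _ => AR.
  pose DA := meager_open_part A; pose W := meager_open_part (R `\` A).
  have oDW : open (DA `|` W) by apply: openU; exact: open_meager_open_part.
  exists W; split; first exact: open_meager_open_part; last first.
    apply: first_category_subset (meager_open_partP (R `\` A) bU).
    by move=> x [[Wx Rx] nA].
  have bdDW := nowhere_dense_first_category (nowhere_dense_boundary oDW).
  apply: first_category_subset
    (first_categoryU (meager_open_partP A bU) bdDW) => x [Ax nWx].
  have [DAx|nDAx] := pselect (DA x); [by left|right].
  split; last by case.
  apply: contrapT => ncx; have [Ex nGx] := AR x Ax.
  (* Neither [A] nor [R] minus [A] is meager in any nonempty open subset of the basic set [U k]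
     found here, so [A] splits [E] in it. Then [k] is good, although [U k] avoids [G]. *)
  have [||k [Ukx UkV]] := Ub (~` closure (DA `|` W) `&` ~` closure G) x.
  - by apply: openI; apply/closed_openC/closed_closure.
  - by split.
  apply: nGx; apply: subset_closure; exists k => //; exists (U k `&` A).
  (* A meager trace would put [V] intersected with [U k] inside [DA] or [W], which [U k] avoids;
     hence this intersection is empty. *)
  have void V B : open V -> first_category (V `&` (U k `&` B)) ->
      meager_open_part B `<=` DA `|` W -> first_category (V `&` (U k `&` E)).
    move=> oV fV BDW; apply: first_category_subset (first_category0 X).
    move=> z [Vz [Ukz _]]; have [nDW _] := UkV z Ukz; apply: nDW.
    apply: subset_closure; apply: BDW; exists (V `&` U k) => //.
    by split; [exact: openI|rewrite -setIA].
  split=> [z [? /AR[]]//|V oV fV|V oV fV].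
    exact: (void V A).
  apply: (void V (R `\` A)) => //.
  apply: first_category_subset fV => z [Vz [Ukz [[Ez _] nA]]].
  by split=> //; split=> // -[].
have fG : first_category (E `\` G).
  have bdG := nowhere_dense_first_category (nowhere_dense_boundary oG).
  apply: first_category_subset (first_categoryU fR bdG) => x [Ex nGx].
  by have [cx|ncx] := pselect (closure G x); [right|left].
have /choice [S SP] (k : nat) : exists A, good k -> splits (U k `&` E) A.
  have [[A AP]|ng] := pselect (good k); first by exists A.
  by exists set0.
pose glue (T : nat -> set X) := [set x | exists k, [/\ good k, T k x &
    forall j, j < k -> good j -> ~ U j x]].
exists (glue S); split.
- by move=> x [k [gk Sx _]]; have [/(_ x Sx)[]] := SP k gk.
- by apply: openly_full_glue => // k gk; have [] := SP k gk.
(* Both gluings assign a point to the same least index, so gluing the complements stays outside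
   [glue S]. *)
apply: (@openly_full_subset _ _ (glue (fun k => (U k `&` E) `\` S k))).
  move=> x [k [gk [[Ukx Ex] nSx] kmin]]; split=> // -[j [gj Sjx jmin]].
  have [/(_ x Sjx)[Ujx _] _ _] := SP j gj.
  have [jk|kj|ejk] := ltngtP j k.
  - exact: (kmin j).
  - exact: (jmin k).
  - by apply: nSx; rewrite -ejk.
by apply: openly_full_glue => // k gk; have [] := SP k gk.
Qed.

(** * Infinite decompositions *)

Lemma infinite_openly_full_decomposition (X : topologicalType)
    (U : nat -> set X) (E : set X) :
  countable_base U -> (forall x : X, first_category [set x]) ->
  ~ first_category E ->
  exists2 F : set (set X), infinite_decomposition E F &
    forall D, F D -> openly_full E D.
Proof.
move=> bU fc1 nfE.
have /choice [s sP] (Q : set X) := openly_full_split Q bU fc1.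
pose R n := iter n (fun Q => Q `\` s Q) E.
(* [R n] is what remains after [n] splittings and [s (R n)] the piece removed next; transitivity
   makes both full in [E]. *)
have RS n : R n.+1 = R n `\` s (R n) by [].
have Rdec m n : m <= n -> R n `<=` R m.
  elim: n => [|n IH]; first by rewrite leqn0 => /eqP ->.
  rewrite leq_eqVlt => /predU1P[->//|/IH Rnm] x; rewrite RS => -[Rx _].
  exact: Rnm.
have fullR n : openly_full E (R n).
  elim: n => [//|n IH]; apply: openly_full_trans IH _.
  by rewrite RS; have [] := sP (R n).
have fulls n : openly_full E (s (R n)).
  by apply: openly_full_trans (fullR n) _; have [] := sP (R n).
have sR n : s (R n) `<=` R n by have [] := sP (R n).
(* The points never removed are put into the piece of index 0. *)
pose D n := s (R n) `|` [set x | n = 0 /\ forall m, R m x].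
have fullD n : openly_full E (D n).
  by apply: openly_full_subset (fulls n) => x; left.
(* A full subset of a nonmeager set cannot be empty; with disjointness this makes the pieces
   distinct. *)
have D0 n : D n !=set0.
  apply/set0P/eqP => Dn; apply: nfE; rewrite -[E]setTI; apply: (fullD n) => //.
    exact: openT.
  by rewrite Dn setI0; exact: first_category0.
have disj m n x : m < n -> D m x -> D n x -> False.
  move=> mn Dm Dn; have Rx : R m.+1 x.
    by apply: (Rdec _ n) => //; case: Dn => [/sR|[]].
  case: Dm => [sx|[_ Rall]]; first by move: Rx; rewrite RS => -[].
  by case: Dn mn => [sx|[->]] //; have := Rall n.+1; rewrite RS => -[].
have Dtriv m n x : D m x -> D n x -> m = n.
  move=> Dm Dn; have [mn|nm|//] := ltngtP m n; first by case: (disj m n x).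
  by case: (disj n m x).
have Dinj : injective D.
  move=> m n eD; have [x Dx] := D0 m; apply: (Dtriv m n x) => //.
  by rewrite -eD.
exists (range D); last by move=> _ [n _ <-].
split.
- rewrite (@eq_finite_set _ _ _ [set: nat]).
    exact: infinite_nat.
  by apply: inj_card_eq => m n _ _; exact: Dinj.
- by move=> _ _ [m _ <-] [n _ <-] [x [Dm Dn]]; rewrite (Dtriv m n x).
- apply/seteqP; split=> [x [_ [n _ <-]] [/sR Rx|[_ /(_ 0)]//]|x Ex].
    exact: (Rdec 0 n).
  have [Rall|/existsNP nR] := pselect (forall m, R m x).
    by exists (D 0); [exists 0|right].
  (* The least [n] with [x] outside [R n] is positive since [R 0] is [E], so [x] was removed at the
     preceding stage. *)
  have [|n /asboolP nRn nmin] := @ex_minnP (fun n => `[< ~ R n x >]).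
    by have [m nRm] := nR; exists m; apply/asboolP.
  case: n nRn nmin => [//|n] nRn nmin; exists (D n); first by exists n.
  left; apply: contrapT => nsx; apply: nRn; rewrite RS; split=> //.
  apply: contrapT => nRx; have := nmin n; rewrite ltnn => /(_ _)/notF; apply.
  exact/asboolP.
Qed.

Lemma infinite_singleton_decomposition (T : Type) (E : set T) :
  infinite_set E -> infinite_decomposition E (set1 @` E).
Proof.
move=> infE; split.
- rewrite (@eq_finite_set _ _ _ E) //.
  by apply: inj_card_eq => x y _ _ /seteqP[/(_ x erefl)].
- by move=> _ _ [x _ <-] [y _ <-] [z [-> ->]].
- apply/seteqP; split=> [x [_ [y Ey <-] ->]//|x Ex].
  by exists [set x] => //; exists x.
Qed.

Theorem corollary3p2 (X : topologicalType)
  (X_second_countable : @second_countable X)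
  (X_T1 : accessible_space X)
  (X_no_isolated : isolated [set: X] = set0)
  (E : set X) (E_infinite : infinite_set E) :
  (exists2 F : set (set X), infinite_decomposition E F &
     forall D, F D ->
       full_subset (@Baire_property X) (@first_category X) E D) /\
  (forall F : set (set X), infinite_decomposition E F ->
     ((forall D, F D ->
         full_subset (@Baire_property X) (@first_category X) E D) <->
      (forall D, F D ->
         completely_non_Baire_subset (@Baire_property X) (@first_category X)
           E D))).
Proof.
have fc1 (x : X) : first_category [set x] by exact: first_category1.
have [U bU] := second_countable_base X_second_countable.
have subE F D : infinite_decomposition E F -> F D -> D `<=` E.
  by move=> [_ _ <-] FD x Dx; exists D.
split.
  have [fE|nfE] := pselect (first_category E).
    exists (set1 @` E); first exact: infinite_singleton_decomposition.
    move=> _ [x Ex <-]; split=> [y ->//|B _ _].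
    by apply: first_category_subset fE => y [].
  have [F dF fullF] := infinite_openly_full_decomposition bU fc1 nfE.
  exists F => // D FD; apply/full_subsetP; first exact: (subE F).
  exact: fullF.
move=> F dF; have [infF trF unF] := dF.
split=> h D FD; have DE := subE F D dF FD; last first.
  exact/(full_subsetP DE)/completely_non_Baire_openly_full/h.
apply: openly_full_completely_non_Baire => //; first exact/(full_subsetP DE)/h.
(* Infinity of [F] supplies another member, disjoint from [D]. It is full and lies in [E] minus [D],
   which is therefore full too. *)
have [D' [FD' D'D]] : F `\` [set D] !=set0.
  by apply: infinite_setN0; apply: infinite_setD => //; exact: finite_set1.
have D'E := subE F D' dF FD'.
apply: (@openly_full_subset _ _ D'); last exact/(full_subsetP D'E)/h.
move=> x D'x; split; first exact: D'E.
by move=> Dx; apply: D'D; apply: trF => //; exists x.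
Qed.
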